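(* Let $f\in\mathbb H^{N_1\times N_2}$ and set $$g(\xi_1,\xi_2)=e^{-i(a_1\xi_1^2\Delta t_1^2+d_1\xi_1\Delta t_1)}f(\xi_1,\xi_2)e^{-j(a_2\xi_2^2\Delta t_2^2+d_2\xi_2\Delta t_2)}.$$ Then the two-sided DQQPFT of $f$ is related to the two-sided discrete quaternion Fourier transform $\mathcal F^{\mathbb H}$ of $g$ by $$\mathcal Q^{\mathbb H}_{\mathfrak B_1\mathfrak B_2}[f](\omega_1,\omega_2)=\frac1{\sqrt{N_1}}\frac1{\sqrt{N_2}}\,e^{-i(c_1\omega_1^2\Delta u_1^2+e_1\omega_1\Delta u_1)}\,\mathcal F^{\mathbb H}[g](\omega_1,\omega_2)\,e^{-j(c_2\omega_2^2\Delta u_2^2+e_2\omega_2\Delta u_2)}.$$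
   Context: $\mathbb H$ is the algebra of real quaternions with units $i,j,k$, $i^2=j^2=k^2=ijk=-1$, $ij=-ji=k$. Fix positive integers $N_1,N_2$. For $s=1,2$ let $\mathfrak B_s=(a_s,b_s,c_s,d_s,e_s)$ be real parameters with $b_s\neq 0$, let $\Delta t_s>0$ be a sampling interval and $\Delta u_s=2\pi b_s/(N_s\Delta t_s)$. A signal $f\in\mathbb H^{N_1\times N_2}$ is an array of quaternions $f(\xi_1,\xi_2)$, $\xi_s\in\{0,\dots,N_s-1\}$. Its two-sided discrete quaternion quadratic phase Fourier transform (DQQPFT) is $$\mathcal Q^{\mathbb H}_{\mathfrak B_1\mathfrak B_2}[f](\omega_1,\omega_2)=\frac1{\sqrt{N_1N_2}}\sum_{\xi_1=0}^{N_1-1}\sum_{\xi_2=0}^{N_2-1}e^{-i(a_1\xi_1^2\Delta t_1^2+\frac{2\pi}{N_1}\xi_1\omega_1+c_1\omega_1^2\Delta u_1^2+d_1\xi_1\Delta t_1+e_1\omega_1\Delta u_1)}f(\xi_1,\xi_2)\,e^{-j(a_2\xi_2^2\Delta t_2^2+\frac{2\pi}{N_2}\xi_2\omega_2+c_2\omega_2^2\Delta u_2^2+d_2\xi_2\Delta t_2+e_2\omega_2\Delta u_2)},$$ for $\omega_s\in\{0,\dots,N_s-1\}$, where for real $x$, $e^{-ix}=\cos x-i\sin x$ and $e^{-jx}=\cos x-j\sin x$. The two-sided discrete quaternion Fourier transform (DQFT) is $$\mathcal F^{\mathbb H}[g](\omega_1,\omega_2)=\sum_{\xi_1=0}^{N_1-1}\sum_{\xi_2=0}^{N_2-1}e^{-i\frac{2\pi}{N_1}\xi_1\omega_1}g(\xi_1,\xi_2)e^{-j\frac{2\pi}{N_2}\xi_2\omega_2}.$$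 *)

(* Defs.v *)
From HB Require Import structures.
From mathcomp Require Import all_boot all_order all_algebra ring.
From mathcomp Require Import all_reals all_analysis.

Set Implicit Arguments.
Unset Strict Implicit.
Unset Printing Implicit Defensive.

Import GRing.Theory.
Local Open Scope ring_scope.

                                                          
Record quaternion (R : Type) := Quaternion { qre : R; qim : R; qjm : R; qkm : R }.

Section QuaternionAlgebra.
Variable R : comNzRingType.
Implicit Types p q r : quaternion R.

Let enc q := (qre q, qim q, qjm q, qkm q).
Let dec (t : R * R * R * R) : quaternion R :=
  let: (a, b, c, d) := t in Quaternion a b c d.
Fact quaternion_encK : cancel enc dec. Proof. by case. Qed.

HB.instance Definition _ := Choice.copy (quaternion R) (can_type quaternion_encK).

Definition addq p q :=
  Quaternion (qre p + qre q) (qim p + qim q) (qjm p + qjm q) (qkm p + qkm q).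
Definition oppq p := Quaternion (- qre p) (- qim p) (- qjm p) (- qkm p).
Definition scaleq (x : R) p :=
  Quaternion (x * qre p) (x * qim p) (x * qjm p) (x * qkm p).
Definition mulq p q :=
  let: Quaternion a b c d := p in
  let: Quaternion a' b' c' d' := q in
  Quaternion (a * a' - b * b' - c * c' - d * d')
             (a * b' + b * a' + c * d' - d * c')
             (a * c' - b * d' + c * a' + d * b')
             (a * d' + b * c' - c * b' + d * a').

Fact addqA : associative addq.
Proof. by move=> p q r; rewrite /addq /= !addrA. Qed.
Fact addqC : commutative addq.
Proof. by case=> a b c d [a' b' c' d']; congr Quaternion; apply: addrC. Qed.
Fact add0q : left_id (Quaternion 0 0 0 0) addq.
Proof. by case=> a b c d; rewrite /addq /= !add0r. Qed.
Fact addNq : left_inverse (Quaternion 0 0 0 0) oppq addq.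
Proof. by case=> a b c d; rewrite /addq /= !addNr. Qed.

HB.instance Definition _ :=
  GRing.isZmodule.Build (quaternion R) addqA addqC add0q addNq.

Fact mulqA : associative mulq.
Proof. by case=> a b c d [? ? ? ?] [? ? ? ?]; congr Quaternion; ring. Qed.
Fact mul1q : left_id (Quaternion 1 0 0 0) mulq.
Proof. by case=> a b c d; congr Quaternion; ring. Qed.
Fact mulq1 : right_id (Quaternion 1 0 0 0) mulq.
Proof. by case=> a b c d; congr Quaternion; ring. Qed.
Fact mulqDl : left_distributive mulq +%R.
Proof. by case=> a b c d [? ? ? ?] [? ? ? ?]; congr Quaternion; rewrite /=; ring. Qed.
Fact mulqDr : right_distributive mulq +%R.
Proof. by case=> a b c d [? ? ? ?] [? ? ? ?]; congr Quaternion; rewrite /=; ring. Qed.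
Fact oneq_neq0 : Quaternion 1 0 0 0 != 0 :> quaternion R.
Proof. by apply/eqP=> -[] /eqP; rewrite oner_eq0. Qed.

HB.instance Definition _ :=
  GRing.Zmodule_isNzRing.Build (quaternion R)
    mulqA mul1q mulq1 mulqDl mulqDr oneq_neq0.

Fact scaleqA x y p : scaleq x (scaleq y p) = scaleq (x * y) p.
Proof. by rewrite /scaleq /= !mulrA. Qed.
Fact scale1q : left_id 1 scaleq.
Proof. by case=> a b c d; rewrite /scaleq /= !mul1r. Qed.
Fact scaleqDr : right_distributive scaleq +%R.
Proof. by move=> x p q; congr Quaternion; rewrite mulrDr. Qed.
Fact scaleqDl p : {morph scaleq^~ p : x y / x + y}.
Proof. by move=> x y; congr Quaternion; rewrite mulrDl. Qed.

HB.instance Definition _ :=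
  GRing.Zmodule_isLmodule.Build R (quaternion R) scaleqA scale1q scaleqDr scaleqDl.

Fact scaleqAl x p q : x *: (p * q) = x *: p * q.
Proof. by case: p q => a b c d [? ? ? ?]; congr Quaternion; rewrite /=; ring. Qed.
HB.instance Definition _ := GRing.Lmodule_isLalgebra.Build R (quaternion R) scaleqAl.

Fact scaleqAr x p q : x *: (p * q) = p * (x *: q).
Proof. by case: p q => a b c d [? ? ? ?]; congr Quaternion; rewrite /=; ring. Qed.
HB.instance Definition _ := GRing.Lalgebra_isAlgebra.Build R (quaternion R) scaleqAr.

End QuaternionAlgebra.

Definition qI {R : comNzRingType} : quaternion R := Quaternion 0 1 0 0.
Definition qJ {R : comNzRingType} : quaternion R := Quaternion 0 0 1 0.
Definition qK {R : comNzRingType} : quaternion R := Quaternion 0 0 0 1.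

Lemma quaternionE (R : comNzRingType) (a b c d : R) :
  Quaternion a b c d = a%:A + b *: qI + c *: qJ + d *: qK.
Proof. by congr Quaternion; rewrite /=; ring. Qed.

Lemma quaternion_units (R : comNzRingType) :
  [/\ qI * qI = -1 :> quaternion R, qJ * qJ = -1 :> quaternion R,
      qK * qK = -1 :> quaternion R, qI * qJ * qK = -1 :> quaternion R
    & qI * qJ = qK :> quaternion R /\ qJ * qI = - qK :> quaternion R].
Proof. by do ?split; congr Quaternion; rewrite /=; ring. Qed.

                         
Definition expNi (R : realType) (x : R) : quaternion R := (cos x)%:A - sin x *: qI.
Definition expNj (R : realType) (x : R) : quaternion R := (cos x)%:A - sin x *: qJ.

Record qpf_param (R : Type) :=
  QPFParam { qpf_a : R; qpf_b : R; qpf_c : R; qpf_d : R; qpf_e : R }.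

                                                                           
                           
Definition freq_step (R : realType) (N : nat) (B : qpf_param R) (dt : R) : R :=
  2 * pi * qpf_b B / (N%:R * dt).

Definition qpf_phase (R : realType) (N : nat) (B : qpf_param R) (dt : R)
    (xi w : 'I_N) : R :=
  let du := freq_step N B dt in
  qpf_a B * xi%:R ^+ 2 * dt ^+ 2 + 2 * pi / N%:R * xi%:R * w%:R
  + qpf_c B * w%:R ^+ 2 * du ^+ 2 + qpf_d B * xi%:R * dt + qpf_e B * w%:R * du.

Definition dqqpft (R : realType) (N1 N2 : nat) (B1 B2 : qpf_param R) (dt1 dt2 : R)
    (f : 'M[quaternion R]_(N1, N2)) : 'M[quaternion R]_(N1, N2) :=
  \matrix_(w1, w2) ((Num.sqrt (N1%:R * N2%:R))^-1 *:
    \sum_(xi1 < N1) \sum_(xi2 < N2)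
      expNi (qpf_phase B1 dt1 xi1 w1) * f xi1 xi2 * expNj (qpf_phase B2 dt2 xi2 w2)).

Definition dqft (R : realType) (N1 N2 : nat)
    (g : 'M[quaternion R]_(N1, N2)) : 'M[quaternion R]_(N1, N2) :=
  \matrix_(w1, w2) \sum_(xi1 < N1) \sum_(xi2 < N2)
    expNi (2 * pi / N1%:R * xi1%:R * w1%:R) * g xi1 xi2
    * expNj (2 * pi / N2%:R * xi2%:R * w2%:R).

(* Main.v *)
Require Import Defs.
From mathcomp Require Import all_boot all_order all_algebra.
From mathcomp Require Import all_reals all_analysis.
From mathcomp Require Import ring.

(** Each one-sided kernel takes sums of phases to products of quaternions
    ([expNiD], [expNjD]), because its values lie in the commutative subalgebra
    spanned by 1 and i (resp. 1 and j), a copy of the complex numbers.  The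
    quadratic phase is the sum of a chirp in the space variable, the Fourier
    phase, and a chirp in the frequency variable ([qpf_phaseE]).  Splitting both
    kernels accordingly, the space chirps are the ones nearest to the signal and
    turn [f] into [g], the Fourier factors surround them, and the frequency
    chirps are outermost; these do not depend on the summation variables, so
    they leave the double sum, one on each side.  The quaternion product is not
    commutative, and the order of the factors is free only within each side,
    which is all that this regrouping uses. *)

Import GRing.Theory Num.Theory.

Local Open Scope ring_scope.

Lemma expNiD (R : realType) (x y : R) : expNi (x + y) = expNi x * expNi y.
Proof. by rewrite /expNi cosD sinD; congr Quaternion; rewrite /=; ring. Qed.

Lemma expNjD (R : realType) (x y : R) : expNj (x + y) = expNj x * expNj y.
Proof. by rewrite /expNj cosD sinD; congr Quaternion; rewrite /=; ring. Qed.

Lemma qpf_phaseE (R : realType) (N : nat) (B : qpf_param R) (dt : R)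
    (xi w : 'I_N) :
  let du := freq_step N B dt in
  qpf_phase B dt xi w =
    (qpf_a B * xi%:R ^+ 2 * dt ^+ 2 + qpf_d B * xi%:R * dt)
    + 2 * pi / N%:R * xi%:R * w%:R
    + (qpf_c B * w%:R ^+ 2 * du ^+ 2 + qpf_e B * w%:R * du).
Proof. by rewrite /qpf_phase /=; ring. Qed.

Theorem mainTheorem8 (R : realType) (N1 N2 : nat)
    (hN1 : (0 < N1)%N) (hN2 : (0 < N2)%N)
    (B1 B2 : qpf_param R) (hb1 : qpf_b B1 != 0) (hb2 : qpf_b B2 != 0)
    (dt1 dt2 : R) (hdt1 : 0 < dt1) (hdt2 : 0 < dt2)
    (f : 'M[quaternion R]_(N1, N2)) (w1 : 'I_N1) (w2 : 'I_N2) :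
  let du1 := freq_step N1 B1 dt1 in
  let du2 := freq_step N2 B2 dt2 in
  let g : 'M[quaternion R]_(N1, N2) := \matrix_(xi1 < N1, xi2 < N2)
    (expNi (qpf_a B1 * xi1%:R ^+ 2 * dt1 ^+ 2 + qpf_d B1 * xi1%:R * dt1)
     * f xi1 xi2
     * expNj (qpf_a B2 * xi2%:R ^+ 2 * dt2 ^+ 2 + qpf_d B2 * xi2%:R * dt2)) in
  dqqpft B1 B2 dt1 dt2 f w1 w2 =
    ((Num.sqrt N1%:R)^-1 * (Num.sqrt N2%:R)^-1) *:
      (expNi (qpf_c B1 * w1%:R ^+ 2 * du1 ^+ 2 + qpf_e B1 * w1%:R * du1)
       * dqft g w1 w2
       * expNj (qpf_c B2 * w2%:R ^+ 2 * du2 ^+ 2 + qpf_e B2 * w2%:R * du2)).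
Proof.
move=> du1 du2 g; rewrite !mxE sqrtrM ?ler0n // invfM; congr (_ *: _).
rewrite mulr_sumr mulr_suml; apply: eq_bigr => xi1 _.
rewrite mulr_sumr mulr_suml; apply: eq_bigr => xi2 _.
rewrite !qpf_phaseE mxE -/du1 -/du2 !expNjD.
(* The left kernel must list its factors from the outermost inwards, the right
   kernel from the innermost outwards. *)
rewrite addrC [X in expNi (_ + X)]addrC !expNiD.
by rewrite !mulrA.
Qed.
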